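(* Let $V\subset\mathbb{Z}$ be a set with at least three elements, not necessarily finite, such that the sizes of the gaps between successive elements of $V$ are bounded above. Let $r\ge s$ be the sizes of the two largest gaps between successive elements of $V$. For $(q,c)\in\mathbb{N}\times\mathbb{Z}$, let $\Pi_{(q,c)}$ be the collection of multisets with support in $V$, of cardinality $q$ and sum $c$, and let $\Delta_{(q,c)}$ be the simplicial complex generated by the supports of the multisets in $\Pi_{(q,c)}$. If $q>r+s$, then $\Delta_{(q,c)}$ is connected.
   Context: A multiset is an unordered collection of elements in which elements may appear with multiplicity greater than one; cardinality and sum are counted with multiplicity, and the support is the set of distinct elements occurring. A gap of $V$ is a pair of successive elements $v<v'$ of $V$ (no element of $V$ lies strictly between them), and its size is $v'-v$. The two largest gaps are counted with multiplicity: if there is more than one gap of the largest size, then $r=s$. The complex generated by a family of finite sets consists of all subsets of members of the family; its vertices are the elements of $V$ that occur in some multiset in $\Pi_{(q,c)}$. Connected means any two vertices are joined by a path of edges, i.e. there is at most one connected component (a complex with no vertices is regarded as connected). *)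

(* Defs.v *)
From mathcomp Require Import all_boot all_order all_algebra.
From mathcomp Require Import finmap multiset.
From mathcomp Require Import boolp classical_sets functions cardinality.

Set Implicit Arguments.
Unset Strict Implicit.
Unset Printing Implicit Defensive.

Import Order.TTheory GRing.Theory Num.Theory.

Local Open Scope classical_set_scope.
Local Open Scope fset_scope.
Local Open Scope mset_scope.
Local Open Scope ring_scope.

Definition gap (V : set int) : set (int * int) :=
  [set g | [/\ V g.1, V g.2, g.1 < g.2 & forall w, V w -> ~ (g.1 < w < g.2)]].

Definition gap_size (g : int * int) : int := g.2 - g.1.

(* Gaps are pairs of elements, so [g1 != g2] compares gaps and not sizes:
   a largest size attained by several gaps gives r = s. *)
Definition two_largest_gap_sizes (V : set int) (r s : int) : Prop :=
  exists g1 g2 : int * int,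
    [/\ gap V g1, gap V g2, g1 != g2, gap_size g1 = r & gap_size g2 = s] /\
    (forall g, gap V g -> gap_size g <= r) /\
    (forall g, gap V g -> g != g1 -> gap_size g <= s).

Definition Pi_mset (V : set int) (q : nat) (c : int) : set {mset int} :=
  [set M : {mset int} |
    [/\ (forall x, x \in finsupp M -> V x), size M = q & \sum_(x <- M) x = c]].

Definition generated_complex (T : choiceType) (S : set {fset T}) :
    set {fset T} :=
  [set F | exists2 E, S E & (F `<=` E)%fset].

Definition Delta (V : set int) (q : nat) (c : int) : set {fset int} :=
  generated_complex [set finsupp M | M in Pi_mset V q c].

Definition vertex (T : choiceType) (K : set {fset T}) : set T :=
  [set x | K [fset x]%fset].

Definition edge (T : choiceType) (K : set {fset T}) (x y : T) : Prop :=
  x != y /\ K [fset x; y]%fset.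

(* The complex without vertices is connected. *)
Definition connected_complex (T : choiceType) (K : set {fset T}) : Prop :=
  forall x y, vertex K x -> vertex K y ->
    exists2 p : seq T, path (fun a b => `[< edge K a b >]) x p & last x p = y.

(* Main.v *)
Require Import Defs.
From mathcomp Require Import all_boot all_order all_algebra.
From mathcomp Require Import finmap multiset.
From mathcomp Require Import boolp classical_sets functions cardinality.
From mathcomp Require Import zify ring lra.

(** Multisets of cardinality [q] are handled as tuples [a : T -> int] with
    [#|T| = q].  Call [a] and [b] far apart if they have the same sum [c] but
    their supports lie in different components of the complex.  Changing fewer
    than [q] entries of [a] without changing the sum leaves it in its component,
    so the tuple obtained is still far from [b].  Suppose that some pair is far
    apart, and take a far pair with least [cost a b = \sum_i `|a i - b i|].
    No [a i] equals a [b j], so each index is up ([a i < b i]) or down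
    ([b i < a i]).  Let [p] and [n] be the numbers of up and down indices, and
    let [D = r + s < q], a bound for the sum of the sizes of any two distinct
    gaps.

    Balanced moves.  Move some entries of [a] down by one gap each and others
    up by one gap each.  By [balanced_subset], if there are [k] candidates for
    moving down, through gaps of size at most [m], and [m] candidates for moving
    up, through gaps of size at most [k], then a nonempty selection of at most
    [k + m] of these moves preserves the sum.  When [k + m <= D < q] the new
    tuple is still far from [b].  If only up indices move up, the cost changes by
    minus twice the total displacement of the down indices ([cost_shift]).
    Hence in a closest pair no down index is ever selected, and then the cost is
    unchanged.  Minimality also shows that an up and a down index never cross the
    same gap ([crossings_distinct]), so the two sorts of gaps involved have sizes
    adding up to at most [D].

    The stalling argument ([stalled]).  Exchanging [a] and [b] if necessary, the
    gaps next to the down indices have size at most [p].  Let [v] be the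
    least [b i] and [w] the greatest [a i] over the down indices.  Offer as
    candidates for moving down first the down indices, then the up indices with
    [v < a i] in increasing order, and as candidates for moving up the remaining
    up indices.  Such moves increase [\sum_i min (a i) v] or, leaving it
    unchanged, [\sum_i a i ^+ 2], so they come to an end, with
    [b] and the down entries of [a] untouched.  At that point some up index [e] with [a e < v] has above
    [a e] a gap of size greater than [n + #{i up | v < a i}].  By the symmetric
    argument, [b] can be changed so that some up index [f] with [w < b f] has
    below [b f] a gap of size greater than [n + #{i up | b i < w}].  These two
    gaps are distinct, since one lies below [v] and the other above [w], so
    their sizes add up to at most [D < q]; this forces more than [n] up indices
    to satisfy [a i < v < w < b i].  Each of them moves up by more than [w - v],
    whereas each of the [n] down indices moves down by at most [w - v].  So the
    sum of [b] exceeds that of [a], a contradiction. *)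

Set Implicit Arguments.
Unset Strict Implicit.
Unset Printing Implicit Defensive.

Import Order.TTheory GRing.Theory Num.Theory.

Local Open Scope ring_scope.
Local Open Scope set_scope.

(** * Maxima, subfamilies of equal sum and initial segments *)

Lemma exists_max_int (X : Type) (P : X -> Prop) (f : X -> int) (B : int) :
  (exists x, P x) -> (forall x, P x -> f x <= B) ->
  exists x, P x /\ forall y, P y -> f y <= f x.
Proof.
move=> [x0 Px0] fB.
have exN : exists n, `[< exists2 x, P x & `|B - f x|%N = n >].
  by exists `|B - f x0|%N; apply/asboolP; exists x0.
case: (ex_minnP exN) => n /asboolP[x Px xn] nmin.
exists x; split=> // y Py.
have /nmin : `[< exists2 z, P z & `|B - f z|%N = `|B - f y|%N >].
  by apply/asboolP; exists y.
by have := fB _ Px; have := fB _ Py; lia.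
Qed.

(** A nonempty set of least cardinality that [f] maps into itself is permuted by
    [f]. *)
Lemma stable_subset (W : finType) (f : W -> W) (w : W) :
  exists S : {set W}, [/\ S != finset.set0, {in S &, injective f} & [set f x | x in S]%SET = S].
Proof.
pose P (S : {set W}) := (S != finset.set0) && ([set f x | x in S]%SET \subset S).
have PT : P [set: W]%SET.
  by rewrite /P finset.subsetT andbT; apply/finset.set0Pn; exists w; rewrite inE.
case: (arg_minnP (fun S : {set W} => #|S|) PT) => S /andP[S0 fS] Smin.
have PfS : P [set f x | x in S]%SET.
  rewrite /P; apply/andP; split; last exact: imsetS.
  by case/finset.set0Pn: S0 => x xS; apply/finset.set0Pn; exists (f x); apply: imset_f.
have cS : #|[set f x | x in S]%SET| = #|S|.
  by apply/eqP; rewrite eqn_leq leq_imset_card Smin.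
exists S; split=> //; first by apply/imset_injP; rewrite cS.
by apply/eqP; rewrite eqEcard fS cS leqnn.
Qed.

Lemma Posz_sum (I : Type) (s : seq I) (P : pred I) (F : I -> nat) :
  (\sum_(i <- s | P i) F i)%N%:Z = \sum_(i <- s | P i) (F i)%:Z.
Proof. exact: (big_morph Posz PoszD). Qed.

(** Two families of small natural numbers have subfamilies of equal sum, not both
    empty.  Attach to the states [s < k] the elements of [Lo] and to the states
    [k <= s < k + m] those of [Hi].  The map raising [s] by the weight of its
    element if [s < k], and lowering it otherwise, stays within the [k + m]
    states: this is what the bounds on the weights are for.  On a set of states
    that it permutes, the displacements add up to zero. *)
Lemma balanced_subset (T : finType) (Lo Hi : {set T}) (k m : nat) (mu : T -> nat) :
  [disjoint Lo & Hi] -> (k <= #|Lo|)%N -> (m <= #|Hi|)%N -> (0 < k)%N ->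
  (forall i, i \in Lo -> (mu i <= m)%N) ->
  (forall i, i \in Hi -> (mu i <= k)%N) ->
  exists S1 S2 : {set T}, [/\ S1 \subset Lo, S2 \subset Hi,
    S1 :|: S2 != finset.set0, (#|S1 :|: S2| <= k + m)%N &
    (\sum_(i in S1) mu i = \sum_(i in S2) mu i)%N]%SET.
Proof.
move=> dLH kLo mHi k0 muLo muHi.
pose elt (s : 'I_(k + m)) : T := match fintype.split s with
  | inl i => enum_val (widen_ord kLo i) | inr j => enum_val (widen_ord mHi j) end.
have eltP (s : 'I_(k + m)) : ((s < k)%N /\ elt s \in Lo) \/ ((k <= s)%N /\ elt s \in Hi).
  rewrite /elt; case: (fintype.splitP s) => [i si|j sj].
    by left; split=> //; exact: enum_valP.
  by right; split; [rewrite sj leq_addr | exact: enum_valP].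
have LH x : x \in Lo -> x \in Hi -> False.
  by move=> xL xH; have := disjointFr dLH xL; rewrite xH.
have elt_inj : injective elt.
  move=> s t; rewrite /elt.
  case: (fintype.splitP s) => [i si|i si]; case: (fintype.splitP t) => [j tj|j tj] e; apply/val_inj.
  - by have /(congr1 val) /= := enum_val_inj e; rewrite si tj.
  - by case: (LH _ (enum_valP (widen_ord kLo i))); rewrite e enum_valP.
  - by case: (LH _ (enum_valP (widen_ord kLo j))); rewrite -e enum_valP.
  - by have /(congr1 val) /= := enum_val_inj e; rewrite si tj => ->.
pose next (s : 'I_(k + m)) : nat :=
  if (s < k)%N then (s + mu (elt s))%N else (s - mu (elt s))%N.
have next_lt s : (next s < k + m)%N.
  have := ltn_ord s; rewrite /next; case: (eltP s) => -[sk si].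
    by rewrite sk; have := muLo _ si; lia.
  by case: (ltnP s k); lia.
have next_diff s : (next s)%:Z - s%:Z =
    if elt s \in Lo then (mu (elt s))%:Z else - (mu (elt s))%:Z.
  rewrite /next; case: (eltP s) => -[sk si].
    by rewrite sk si; lia.
  rewrite ltnNge sk /=.
  case: ifP => [/LH /(_ si) //|_].
  by have := muHi _ si; lia.
have km0 : (0 < k + m)%N by lia.
have [S [S0 finj fS]] := stable_subset (fun s => Ordinal (next_lt s)) (Ordinal km0).
(* Both sums below run over [S], since the map permutes it. *)
have sum0 : \sum_(s in S) ((next s)%:Z - s%:Z) = 0.
  rewrite sumrB; apply/eqP; rewrite subr_eq0 -[in X in _ == X]fS.
  by rewrite big_imset.
pose J := [set elt s | s in S]%SET.
have JLH x : x \in J -> (x \in Hi) = (x \notin Lo).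
  case/imsetP => s _ ->; case: (eltP s) => -[_ si].
    by rewrite si /=; apply/negP => /(LH _ si).
  by rewrite si; symmetry; apply/negP => /LH /(_ si).
exists (J :&: Lo)%SET, (J :&: Hi)%SET; split.
- exact: finset.subsetIr.
- exact: finset.subsetIr.
- case/finset.set0Pn: S0 => s sS; apply/finset.set0Pn; exists (elt s).
  have sJ : elt s \in J by apply: imset_f.
  by rewrite !inE sJ (JLH _ sJ) /= orbN.
- have -> : (J :&: Lo :|: J :&: Hi = J)%SET.
    apply/finset.setP => x; rewrite !inE; case xJ : (x \in J) => //=.
    by rewrite (JLH _ xJ) orbN.
  apply: leq_trans (leq_imset_card _ _) _.
  by rewrite -[X in (_ <= X)%N]card_ord max_card.
- apply/eqP; rewrite -eqz_nat !Posz_sum -subr_eq0.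
  have -> : (J :&: Hi = J :\: Lo)%SET.
    apply/finset.setP => x; rewrite !inE andbC; case xJ : (x \in J); rewrite ?andbF //=.
    by rewrite (JLH _ xJ) andbT.
  rewrite -[X in _ == X]sum0; apply/eqP.
  have -> : \sum_(s in S) ((next s)%:Z - s%:Z) =
     \sum_(i in J) (if i \in Lo then (mu i)%:Z else - (mu i)%:Z).
    rewrite big_imset /=; last by move=> s t _ _; apply: elt_inj.
    by apply: eq_bigr => s _; rewrite next_diff.
  rewrite [RHS](big_setID Lo) /=; congr (_ + _).
    by apply: eq_bigr => i; rewrite inE => /andP[_ ->].
  by rewrite -sumrN; apply: eq_bigr => i; rewrite inE => /andP[/negPf -> _].
Qed.

(** The choice of the candidates for moving down.  Sort [C] with [Im] first and
    the rest by [key], and let [Low] be the shortest initial segment, of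
    length [k] say, such that [u] is at most [k] on all remaining elements outside
    [Im].  Since length [k - 1] does not do, some element [e] that comes no
    earlier than the elements of [Low] has [k <= u e]; this witness is what
    bounds the gaps below the elements of [Low]. *)
Lemma initial_segment (T : finType) (Im C : {set T}) (key : T -> int) (u : T -> nat) :
  Im \subset C -> (forall i, i \notin C -> (u i <= #|C|)%N) ->
  (exists2 i, i \notin Im & (0 < u i)%N) ->
  exists Low : {set T},
    [/\ Low \subset C, (0 < #|Low|)%N, 
        forall i, i \notin Im -> i \notin Low -> (u i <= #|Low|)%N &
        exists e, [/\ e \notin Im, (#|Low| <= u e)%N &
          forall f, f \in Low -> [\/ f \in Im, e \notin C | key f <= key e]]] /\
    ((Low \subset Im) \/ (Im \subset Low)) /\
    {in Low & ~: Low, forall f e, f \notin Im -> e \in C -> key f <= key e}.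
Proof.
move=> ImC uC [i0 i0Im ui0].
pose le x y := (x \in Im) || (y \notin Im) && (key x <= key y).
have le_refl : reflexive le by move=> x; rewrite /le lexx andbT orbN.
have le_tr : transitive le.
  move=> y x z; rewrite /le; case: (x \in Im) => //=.
  by case: (y \in Im) => //= xy; case: (z \in Im) => //=; apply: le_trans.
have le_tot : total le.
  move=> x y; rewrite /le; case: (x \in Im) => //=; case: (y \in Im) => //=.
  exact: le_total.
pose s := sort le (enum C).
have s_sorted : sorted le s by apply: sort_sorted le_tot _.
have s_uniq : uniq s by rewrite sort_uniq enum_uniq.
have s_size : size s = #|C| by rewrite size_sort cardE.
have s_mem x : (x \in s) = (x \in C) by rewrite mem_sort mem_enum.
pose low k := [set x in take k s].
have low_le k x y : x \in low k -> y \in C -> y \notin low k -> le x y.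
  rewrite !inE => xl; rewrite -s_mem -{1}(cat_take_drop k s) mem_cat.
  case/orP=> [->//|yd _].
  have := s_sorted; rewrite (sorted_pairwise le_tr) -(cat_take_drop k s) pairwise_cat.
  by case/andP=> /allrelP sle _; apply: sle.
have card_low k : (k <= #|C|)%N -> #|low k| = k.
  move=> kC; have /card_uniqP ut : uniq (take k s) by apply: take_uniq.
  by rewrite cardsE ut size_takel ?s_size.
have low_C k : low k \subset C.
  by apply/fintype.subsetP => x; rewrite inE => /mem_take; rewrite s_mem.
pose P k := [forall i, (i \notin Im) ==> (i \notin low k) ==> (u i <= k)%N].
have exP : exists k, P k.
  exists #|C|; apply/forallP => i; apply/implyP => _; apply/implyP => il; apply: uC.
  by apply: contra il; rewrite inE take_oversize ?s_size // s_mem.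
case: (ex_minnP exP) => -[|k] Pk kmin.
  have := forallP Pk i0; rewrite i0Im /= inE take0 /=; lia.
have kC : (k < #|C|)%N.
  apply: kmin; apply/forallP => i; apply/implyP => _; apply/implyP => il; apply: uC.
  by apply: contra il; rewrite inE take_oversize ?s_size // s_mem.
have [e [eIm el ue]] : exists e, [/\ e \notin Im, e \notin low k & (k < u e)%N].
  have : ~~ P k by apply/negP => /kmin; rewrite ltnn.
  case/forallPn => e; rewrite !negb_imply -ltnNge => /and3P[eIm el ue].
  by exists e.
pose z := nth i0 s k.
have lowS x : (x \in low k.+1) = (x == z) || (x \in low k).
  by rewrite !inE (take_nth i0) ?s_size // mem_rcons inE.
exists (low k.+1); rewrite card_low //; split; [split=> // | split].
- by move=> i iIm il; have := forallP Pk i; rewrite iIm il.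
- exists e; split=> // f fl.
  case eC: (e \in C); last by constructor 2.
  suff : le f e by rewrite /le eIm /=; case/orP=> ?; [constructor 1 | constructor 3].
  move: fl; rewrite lowS => /orP[/eqP->|fl]; last exact: (low_le k).
  case: (eqVneq e z) => [->|ez]; first exact: le_refl.
  by apply: (low_le k.+1) => //; rewrite lowS ?eqxx // negb_or ez.
- case: (boolP (low k.+1 \subset Im)) => [|/subsetPn[x xl xIm]]; [by left | right].
  apply/fintype.subsetP => y yIm; apply: contraT => yl.
  have := low_le _ _ _ xl (fintype.subsetP ImC _ yIm) yl.
  by rewrite /le (negPf xIm) yIm.
- move=> f e0 fl; rewrite finset.in_setC => el0 fIm eC.
  have := low_le _ _ _ fl eC el0.
  by rewrite /le (negPf fIm) => /andP[].
Qed.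

(** * Gaps and balanced moves *)

Lemma gapE (V : set int) (x y : int) :
  gap V (x, y) <-> [/\ V x, V y, x < y & forall w, V w -> w <= x \/ y <= w].
Proof.
split=> -[Vx Vy xy nV]; split=> // w Vw.
  case: (leP w x) => [|xw]; [by left | right].
  by rewrite leNgt; apply/negP => wy; apply: (nV w Vw) => /=; rewrite xw.
by move=> /andP[/= xw wy]; case: (nV w Vw); rewrite leNgt ?xw ?wy.
Qed.

Lemma gap_above (V : set int) (x y : int) :
  V x -> V y -> x < y -> exists2 z, gap V (x, z) & z <= y.
Proof.
move=> Vx Vy xy.
have [|z [[zV xz] zmax]] := @exists_max_int int (fun z => V z /\ x < z) -%R (- x)
    (ex_intro _ y (conj Vy xy)).
  by move=> z [_]; lia.
exists z; last by have := zmax y (conj Vy xy); lia.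
apply/gapE; split=> // w Vw; case: (ltP x w) => xw; last by left.
by right; have := zmax w (conj Vw xw); lia.
Qed.

Lemma gap_opp (V : set int) (x y : int) :
  gap (fun z => V (- z)) (x, y) <-> gap V (- y, - x).
Proof.
rewrite !gapE; split=> -[Vx Vy xy nV]; split=> //; try lia.
  by move=> w Vw; have := nV (- w); rewrite opprK => /(_ Vw); lia.
by move=> w Vw; have := nV (- w) Vw; lia.
Qed.

Lemma gap_below (V : set int) (x y : int) :
  V x -> V y -> y < x -> exists2 z, gap V (z, x) & y <= z.
Proof.
move=> Vx Vy yx.
have [||| z gz zy] := @gap_above (fun z => V (- z)) (- x) (- y); rewrite ?opprK //; first lia.
by exists (- z); [move/gap_opp: gz; rewrite opprK | lia].
Qed.

(** All that the proof uses of the two largest gap sizes, with [D] their sum. *)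
Definition gap_pairs_le (V : set int) (D : nat) : Prop :=
  forall g1 g2, gap V g1 -> gap V g2 -> g1 <> g2 -> gap_size g1 + gap_size g2 <= D%:Z.

Definition shift (T : finType) (S1 S2 : {set T}) (mu : T -> nat) (a : T -> int) : T -> int :=
  fun i => if i \in S1 then a i - (mu i)%:Z else if i \in S2 then a i + (mu i)%:Z else a i.

Lemma sum_shift (T : finType) (S1 S2 : {set T}) (mu : T -> nat) (a : T -> int)
    (F : T -> int -> int) :
  [disjoint S1 & S2] ->
  \sum_i F i (shift S1 S2 mu a i) = \sum_i F i (a i)
    + \sum_(i in S1) (F i (a i - (mu i)%:Z) - F i (a i))
    + \sum_(i in S2) (F i (a i + (mu i)%:Z) - F i (a i)).
Proof.
move=> dS; rewrite -addrA [X in _ + (X + _)]big_mkcond [X in _ + (_ + X)]big_mkcond /=.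
rewrite -!big_split /=; apply: eq_bigr => i _; rewrite /shift.
case: ifP => i1; first by rewrite (disjointFr dS i1); ring.
by case: ifP => i2; ring.
Qed.

(** The properties of tuples lying in different components that the argument
    needs: a tuple that still shares an entry with the old one lies in the same
    component, and tuples in different components have no common value. *)
Definition separates (V : set int) (T : finType) (far : (T -> int) -> (T -> int) -> Prop) : Prop :=
  [/\ forall a b, far a b -> [/\ forall i, V (a i), forall i, V (b i) & \sum_i a i = \sum_i b i],
      forall a a' b, far a b -> (forall i, V (a' i)) -> \sum_i a' i = \sum_i a i ->
        (exists i, a' i = a i) -> far a' b,
      forall a b b', far a b -> (forall i, V (b' i)) -> \sum_i b' i = \sum_i b i ->
        (exists i, b' i = b i) -> far a b' &
      forall a b i j, far a b -> a i <> b j].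

Definition cost (T : finType) (a b : T -> int) : int := \sum_i `|a i - b i|.

Definition closest (T : finType) (far : (T -> int) -> (T -> int) -> Prop) (a b : T -> int) : Prop :=
  far a b /\ forall a' b', far a' b' -> cost a b <= cost a' b'.


(** A balanced move of fewer than [#|T|] entries leaves one entry in place, hence
    does not leave the component. *)
Lemma far_shift (V : set int) (T : finType) (far : (T -> int) -> (T -> int) -> Prop)
    (a b : T -> int) (S1 S2 : {set T}) (mu : T -> nat) :
  separates V far -> far a b -> [disjoint S1 & S2] -> (#|S1 :|: S2| < #|T|)%N ->
  (\sum_(i in S1) mu i = \sum_(i in S2) mu i)%N ->
  (forall i, i \in S1 -> V (a i - (mu i)%:Z)) ->
  (forall i, i \in S2 -> V (a i + (mu i)%:Z)) ->
  far (shift S1 S2 mu a) b.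
Proof.
move=> [valid left _ _] fab dS cS bal V1 V2; have [Va _ _] := valid _ _ fab.
apply: (left a) => //.
- by move=> i; rewrite /shift; case: ifP => [/V1//|_]; case: ifP => [/V2|].
- rewrite (sum_shift mu a (fun _ x => x) dS).
  under [X in _ + X + _]eq_bigr => i _ do rewrite addrAC subrr add0r.
  under [X in _ + X]eq_bigr => i _ do rewrite addrAC subrr add0r.
  by rewrite sumrN -!Posz_sum bal addrNK.
- have /subsetPn[i _ iS] : ~~ ([set: T] \subset S1 :|: S2).
    by apply: contraL cS => /subset_leq_card; rewrite cardsT -leqNgt.
  exists i; rewrite /shift; move: iS; rewrite inE negb_or => /andP[/negPf-> /negPf->//].
Qed.

(** Entries of [S2] approach their targets and those of [S1] approach them or
    recede according to their side; as both sets move by the same total, only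
    the approaching entries of [S1] matter, and they count twice. *)
Lemma cost_shift (T : finType) (a b : T -> int) (S1 S2 : {set T}) (mu : T -> nat) :
  [disjoint S1 & S2] ->
  (\sum_(i in S1) mu i = \sum_(i in S2) mu i)%N ->
  (forall i, i \in S1 -> b i < a i -> b i <= a i - (mu i)%:Z) ->
  (forall i, i \in S2 -> a i + (mu i)%:Z <= b i) ->
  cost (shift S1 S2 mu a) b =
    cost a b - (\sum_(i in S1 | (b i < a i)%R) mu i)%N%:Z *+ 2.
Proof.
move=> dS bal h1 h2; rewrite /cost (sum_shift mu a (fun i x => `|x - b i|) dS).
rewrite [X in _ + X](eq_bigr (fun i => - (mu i)%:Z)); last by move=> i /h2; lia.
have balZ := congr1 Posz bal; rewrite !Posz_sum in balZ.
rewrite sumrN -balZ -addrA; congr (_ + _).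
rewrite Posz_sum -sumrMnl big_mkcondr /= -sumrB -sumrN.
apply: eq_bigr => i i1; have := h1 _ i1.
by case: ifP => ab; lia.
Qed.

(** * Closest pairs of tuples *)

Lemma sum_min_shift (T : finType) (a : T -> int) (S1 S2 : {set T}) (mu : T -> nat) (v : int) :
  [disjoint S1 & S2] ->
  (forall i, i \in S1 -> v <= a i - (mu i)%:Z) ->
  (forall i, i \in S2 -> a i < v -> a i + (mu i)%:Z <= v) ->
  \sum_i Num.min (shift S1 S2 mu a i) v =
    \sum_i Num.min (a i) v + (\sum_(i in S2 | (a i < v)%R) mu i)%N%:Z.
Proof.
move=> dS h1 h2; rewrite (sum_shift mu a (fun _ x => Num.min x v) dS).
rewrite [X in _ + X + _]big1 ?addr0; last by move=> i /h1; lia.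
congr (_ + _); rewrite Posz_sum big_mkcondr /=; apply: eq_bigr => i /h2.
by case: ifP; lia.
Qed.

(** Spreading out, by moving small entries down and large ones up, increases the
    sum of squares. *)
Lemma sum_sqr_shift (T : finType) (a : T -> int) (S1 S2 : {set T}) (mu : T -> nat) :
  [disjoint S1 & S2] ->
  (\sum_(i in S1) mu i = \sum_(i in S2) mu i)%N -> (0 < \sum_(i in S1) mu i)%N ->
  {in S1 & S2, forall i j, a i <= a j} ->
  \sum_i a i ^+ 2 < \sum_i shift S1 S2 mu a i ^+ 2.
Proof.
move=> dS bal pos a12; rewrite (sum_shift mu a (fun _ x => x ^+ 2) dS) -addrA ltrDl.
have [i1 i1S] : exists i, i \in S1.
  apply/finset.set0Pn; apply/eqP => S10; move: pos; rewrite S10 big1 // => i.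
  by rewrite finset.in_set0.
case: (@Order.TotalTheory.arg_maxP _ _ T i1 [in S1] a i1S) => f fS fmax.
have balZ : \sum_(i in S1) (mu i)%:Z = \sum_(i in S2) (mu i)%:Z by rewrite -!Posz_sum bal.
have posZ : 0 < \sum_(i in S1) (mu i)%:Z by rewrite -Posz_sum; lia.
have h1 : - (a f *+ 2) * \sum_(i in S1) (mu i)%:Z <=
    \sum_(i in S1) ((a i - (mu i)%:Z) ^+ 2 - a i ^+ 2).
  rewrite mulr_sumr; apply: ler_sum => i iS.
  have : 0 <= (mu i)%:Z * (a f - a i) by rewrite mulr_ge0 // subr_ge0; exact: fmax.
  by have := sqr_ge0 (mu i)%:Z; move: (mu i)%:Z => m; lra.
have h2 : (a f *+ 2 + 1) * \sum_(i in S2) (mu i)%:Z <=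
    \sum_(i in S2) ((a i + (mu i)%:Z) ^+ 2 - a i ^+ 2).
  rewrite mulr_sumr; apply: ler_sum => i iS.
  have : 0 <= (mu i)%:Z * (a i - a f) by rewrite mulr_ge0 // subr_ge0; exact: a12.
  have : (mu i)%:Z <= (mu i)%:Z ^+ 2 by case: (mu i) => // n; rewrite expr2 ler_peMl.
  by move: (mu i)%:Z => m; lra.
by rewrite -balZ in h2; lra.
Qed.

(** If an up and a down index crossed the same gap, moving both across it would
    exchange two values of [a] and bring the pair closer together. *)
Lemma crossings_distinct (V : set int) (T : finType) (far : (T -> int) -> (T -> int) -> Prop)
    (a b : T -> int) (i j : T) (x y : int) :
  separates V far -> (2 < #|T|)%N -> closest far a b ->
  b i < a i -> a j < b j -> gap V (x, a i) -> gap V (a j, y) -> (x, a i) <> (a j, y).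
Proof.
move=> sep T2 [fab min_ab] bai abj gi gj [xj yi]; subst x y.
have [valid _ _ _] := sep; have [Va Vb _] := valid _ _ fab.
have /gapE[_ _ ji nV] := gi.
have ij : i != j by apply/eqP => e; subst j; lia.
pose mu (k : T) := `|a i - a j|%N.
have dS : [disjoint [set i] & [set j]]%SET by rewrite disjoints1 !inE.
have bal : (\sum_(k in [set i]%SET) mu k = \sum_(k in [set j]%SET) mu k)%N by rewrite !big_set1.
have fab' : far (shift [set i]%SET [set j]%SET mu a) b.
  apply: (far_shift sep) => //.
  - by rewrite cards2 ij.
  - by move=> k; rewrite inE => /eqP->; have -> : a i - (mu i)%:Z = a j by rewrite /mu; lia.
  - by move=> k; rewrite inE => /eqP->; have -> : a j + (mu j)%:Z = a i by rewrite /mu; lia.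
have := min_ab _ _ fab'; rewrite (cost_shift dS bal).
- rewrite (eq_bigl (fun k => k == i)) ?big_pred1_eq; first by rewrite /mu; lia.
  by move=> k; rewrite inE; case: eqP => //= ->.
- by move=> k; rewrite inE => /eqP-> _; have := nV _ (Vb i); rewrite /mu; lia.
- by move=> k; rewrite inE => /eqP->; have := nV _ (Vb j); rewrite /mu; lia.
Qed.

Definition step_up (V : set int) (x : int) : nat :=
  `|xget x [set y | gap V (x, y)]%classic - x|%N.

Definition step_down (V : set int) (x : int) : nat :=
  `|x - xget x [set y | gap V (y, x)]%classic|%N.

Lemma step_upP (V : set int) (x y : int) :
  V x -> V y -> x < y -> gap V (x, x + (step_up V x)%:Z) /\ x + (step_up V x)%:Z <= y.
Proof.
move=> Vx Vy xy; have [z gz zy] := gap_above Vx Vy xy.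
rewrite /step_up; case: xgetP => [w _ /= gw|/(_ z)//].
have /gapE[_ Vw xw nV] := gw.
have -> : x + `|(w - x)%R|%N%:Z = w by lia.
by split=> //; have := nV y Vy; lia.
Qed.

Lemma step_downP (V : set int) (x y : int) :
  V x -> V y -> y < x -> gap V (x - (step_down V x)%:Z, x) /\ y <= x - (step_down V x)%:Z.
Proof.
move=> Vx Vy xy; have [z gz zy] := gap_below Vx Vy xy.
rewrite /step_down; case: xgetP => [w _ /= gw|/(_ z)//].
have /gapE[Vw _ xw nV] := gw.
have -> : x - `|(x - w)%R|%N%:Z = w by lia.
by split=> //; have := nV y Vy; lia.
Qed.

(** Among the closest pairs that have this [b], these up indices and these values
    at the down indices, choose [a] with greatest [\sum_i min (a i) v], and then
    with greatest [\sum_i a i ^+ 2].  If all up indices below [v] had gaps of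
    size at most [#|C|] above them, where [C] consists of the down indices and
    of the up indices above [v], then [initial_segment] and [balanced_subset]
    would produce a balanced move.  It cannot involve a down index, which would
    reduce the cost; it cannot raise an entry below [v], by the first choice;
    and otherwise it spreads out entries above [v], against the second choice.
    That [v] is a value of [b] is used twice: no [a i] equals [v], and an entry
    above [v] can move down by one gap without passing [v]. *)
Lemma stalled (V : set int) (T : finType) (far : (T -> int) -> (T -> int) -> Prop)
    (D : nat) (a0 b : T -> int) (v : int) :
  separates V far -> gap_pairs_le V D -> (D < #|T|)%N -> (1 < D)%N ->
  closest far a0 b -> (exists j, b j = v) -> (exists i, a0 i < b i) ->
  (forall i x, b i < a0 i -> gap V (x, a0 i) ->
     a0 i - x <= #|[set i | (a0 i < b i)%R]|%:Z) ->
  exists a, [/\ closest far a b, forall i, (a i < b i) = (a0 i < b i),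
    forall i, b i < a0 i -> a i = a0 i &
    exists e y, [/\ a e < b e, a e < v, gap V (a e, y) &
      (#|[set i | (b i < a0 i)%R]| + #|[set i | (a0 i < b i)%R & (v < a i)%R]|)%N%:Z < y - a e]].
Proof.
move=> sep gapsD DT D1 [far0 min0] [jv bjv] [i0 i0up] down_le.
have [valid left _ neq] := sep.
pose Q a := [/\ closest far a b, forall i, (a i < b i) = (a0 i < b i) &
                forall i, b i < a0 i -> a i = a0 i].
have Q0 : Q a0 by [].
have costQ a : Q a -> cost a b = cost a0 b.
  by case=> -[fa mina] _ _; apply/eqP; rewrite eq_le mina // min0.
have [a1 [Qa1 max1]] : exists a, Q a /\ forall a', Q a' ->
    \sum_i Num.min (a' i) v <= \sum_i Num.min (a i) v.
  apply: (exists_max_int (B := \sum_(i : T) v)); first by exists a0.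
  by move=> a _; apply: ler_sum => i _; lia.
have [a [[Qa eq1] max2]] : exists a, (Q a /\ \sum_i Num.min (a i) v = \sum_i Num.min (a1 i) v) /\
    forall a', (Q a' /\ \sum_i Num.min (a' i) v = \sum_i Num.min (a1 i) v) ->
    \sum_i a' i ^+ 2 <= \sum_i a i ^+ 2.
  apply: (exists_max_int (B := \sum_i (`|b i| + cost a0 b) ^+ 2)); first by exists a1.
  move=> a [/costQ Qa _]; apply: ler_sum => i _.
  have : `|a i - b i| <= cost a0 b.
    by rewrite -Qa /cost (bigD1 i) //= lerDl sumr_ge0.
  move=> h; rewrite -(real_normK (num_real (a i))) lerXn2r ?nnegrE ?addr_ge0 //; lia.
have {}max1 a' : Q a' -> \sum_i Num.min (a' i) v <= \sum_i Num.min (a i) v.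
  by rewrite eq1; apply: max1.
have [[fab min_ab] up_eq down_eq] := Qa.
have [Va Vb _] := valid _ _ fab.
exists a; split=> //; apply: contrapT => no_e.
pose Im := [set i | (b i < a i)%R]%SET.
have updown i : (i \notin Im) = (a i < b i).
  by rewrite inE -leNgt le_eqVlt; case: eqP => // /(neq _ _ _ _ fab).
pose C := (Im :|: [set i | v < a i])%SET.
have av i : a i <> v by rewrite -bjv; apply: neq fab.
pose u i := step_up V (a i).
pose d i := step_down V (a i).
have uP i : a i < b i -> gap V (a i, a i + (u i)%:Z) /\ a i + (u i)%:Z <= b i.
  exact: step_upP.
have u_gt0 i : a i < b i -> (0 < u i)%N.
  by case/uP => /gapE[_ _ + _] _; lia.
have ImE : Im = [set i | (b i < a0 i)%R]%SET.
  apply/finset.setP => i; rewrite -[LHS]negbK updown up_eq inE -leNgt.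
  by rewrite le_eqVlt; case: eqP => // /esym /(neq _ _ _ _ far0).
have cardC : #|C| = (#|[set i | (b i < a0 i)%R]| + #|[set i | (a0 i < b i)%R & (v < a i)%R]|)%N.
  rewrite -ImE -(cardsID Im C) /C finset.setUK.
  congr (_ + _)%N; apply: eq_card => i; rewrite finset.in_setD finset.in_setU.
  by rewrite -[i \in Im]negbK updown !inE up_eq; case: ltP.
have uC i : i \notin C -> (u i <= #|C|)%N.
  rewrite finset.in_setU negb_or updown inE => /andP[ab va]; rewrite leqNgt; apply/negP => ui.
  apply: no_e; exists i, (a i + (u i)%:Z); split=> //; last by rewrite -cardC; lia.
    by have := av i; lia.
  by case: (uP _ ab).
have [|Low [[LowC Low0 uLow [e [eIm eLow dom]]] [LowIm Lowle]]] :=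
    initial_segment a (finset.subsetUl Im _) uC.
  by exists i0; rewrite ?updown ?u_gt0 // up_eq.
rewrite updown in eIm.
have LowP f : f \in Low -> [/\ gap V (a f - (d f)%:Z, a f), f \in Im -> b f <= a f - (d f)%:Z &
    f \notin Im -> v <= a f - (d f)%:Z].
  move=> fL; have := fintype.subsetP LowC _ fL; rewrite finset.in_setU => fC.
  case fIm : (f \in Im) fC => /=.
    rewrite inE in fIm => _; have [gf bf] := step_downP (Va f) (Vb f) fIm.
    by split.
  rewrite inE => vf; have Vv : V v by rewrite -bjv.
  by have [gf bf] := step_downP (Va f) Vv vf; split.
have d_gt0 f : f \in Low -> (0 < d f)%N.
  by case/LowP => /gapE[_ _ + _] _ _; lia.
(* [d f] and [u e] are sizes of distinct gaps, so every weight in [Low] is at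
   most [D - #|Low|]. *)
have dD f : f \in Low -> (d f + u e <= D)%N.
  move=> fL; have [gf fIm fnIm] := LowP f fL; have [ge _] := uP e eIm.
  have /(gapsD _ _ gf ge) : (a f - (d f)%:Z, a f) <> (a e, a e + (u e)%:Z).
    case: (boolP (f \in Im)) => [fI|fI].
      apply: (crossings_distinct sep _ (conj fab min_ab) _ eIm gf ge); first by lia.
      by rewrite inE in fI.
    move=> -[ed eu]; have := fnIm fI; case: (dom f fL) => [|eC|]; first by rewrite (negPf fI).
      by move: eC; rewrite finset.in_setU negb_or inE; have := av e; lia.
    by have := u_gt0 e eIm; lia.
  by rewrite /gap_size /=; lia.
have [f0 f0L] : exists f, f \in Low by apply/finset.set0Pn; rewrite -card_gt0.
pose k := #|Low|; pose Hi := (~: (Low :|: Im))%SET.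
have kD : (k <= D)%N by have := dD _ f0L; rewrite /k; lia.
(* [Low] lies inside [Im], and then [Hi] consists of all up indices, or it
   contains [Im], and then [Hi] is its whole complement. *)
have dHi f : f \in Low -> (d f <= #|Hi|)%N.
  move=> fL; case: LowIm => [LI|IL].
    have -> : Hi = [set i | (a0 i < b i)%R]%SET.
      rewrite /Hi (finset.setUidPr LI); apply/finset.setP => i.
      by rewrite finset.in_setC updown inE up_eq.
    have fI := fintype.subsetP LI _ fL; have [gf _ _] := LowP f fL.
    have fI0 : b f < a0 f by move: fI; rewrite ImE inE.
    by move: gf; rewrite (down_eq f fI0) => /(down_le _ _ fI0); lia.
  have -> : Hi = ~: Low by rewrite /Hi (finset.setUidPl IL).
  by have := cardsC Low; have := dD f fL; lia.
have HiP i : i \in Hi -> [/\ i \notin Low, i \notin Im & a i < b i].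
  by rewrite finset.in_setC finset.in_setU negb_or -updown => /andP[].
pose mu i := if i \in Low then d i else u i.
have dLH : [disjoint Low & Hi].
  by rewrite disjoint_sym finset.disjoints_subset finset.setCS finset.subsetUl.
have [||S1 [S2 [S1L S2H S0 cS bal]]] :=
   @balanced_subset T Low Hi k (minn #|Hi| (D - k)) mu dLH (leqnn _) (geq_minl _ _) Low0.
- by move=> f fL; rewrite /mu fL leq_min dHi //=; have := dD f fL; rewrite /k; lia.
- by move=> i /HiP[iL iI _]; rewrite /mu (negPf iL) uLow.
have S1P i : i \in S1 -> i \in Low /\ mu i = d i.
  by move/(fintype.subsetP S1L) => iL; rewrite /mu iL.
have S2P i : i \in S2 -> [/\ i \notin Low, i \notin Im, a i < b i & mu i = u i].
  by move/(fintype.subsetP S2H)/HiP => [iL iI ab]; rewrite /mu (negPf iL).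
have dS : [disjoint S1 & S2] by apply: disjointWl S1L (disjointWr S2H dLH).
have fab' : far (shift S1 S2 mu a) b.
  apply: (far_shift sep) => //.
  - by apply: leq_ltn_trans cS _; rewrite /minn; case: ifP; lia.
  - by move=> i /S1P[/LowP[/gapE[Vd _ _ _] _ _] ->].
  - by move=> i /S2P[_ _ /uP[/gapE[_ Vu _ _] _] ->].
have costS : cost (shift S1 S2 mu a) b =
    cost a b - (\sum_(i in S1 | (b i < a i)%R) mu i)%N%:Z *+ 2.
  apply: cost_shift => // i; first by move=> /S1P[/LowP[_ + _] ->] ab; apply; rewrite inE.
  by move=> /S2P[_ _ /uP[_ + ] ->].
have noIm i : i \in S1 -> i \notin Im.
  move=> iS; apply/negP => iI; have := min_ab _ _ fab'; rewrite costS.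
  have [iL mui] := S1P i iS.
  rewrite (bigD1 i) /=; last by rewrite iS; rewrite inE in iI.
  by have := d_gt0 i iL; rewrite mui; lia.
have Q' : Q (shift S1 S2 mu a).
  split.
  - split=> // a' b' fab2; rewrite costS big1 ?mul0rn ?subr0; first exact: min_ab.
    by move=> i /andP[/noIm + ab]; rewrite inE ab.
  - move=> i; rewrite -up_eq /shift; case: ifP => [iS|_].
      have := noIm i iS; rewrite updown => ab; rewrite ab.
      by apply/idP; lia.
    case: ifP => // iS; have [_ _ ab mui] := S2P i iS; rewrite ab mui.
    have [_ uib] := uP i ab; rewrite lt_neqAle uib andbT; apply/eqP => e'.
    have i1 : i \notin S1 by rewrite (disjointFl dS iS).
    by apply: (neq _ _ i i fab'); rewrite /shift (negPf i1) iS mui.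
  - move=> i iI; rewrite -(down_eq i iI) /shift; have : i \in Im by rewrite ImE inE.
    by move=> iIm; case: ifP => [/noIm|_]; [rewrite iIm | case: ifP => // /S2P[_]; rewrite iIm].
have min_shift : \sum_i Num.min (shift S1 S2 mu a i) v =
    \sum_i Num.min (a i) v + (\sum_(i in S2 | (a i < v)%R) mu i)%N%:Z.
  apply: sum_min_shift => // i.
    by move=> iS; have [/LowP[_ _ + ] ->] := S1P i iS; apply; apply: noIm.
  move=> iS; have [_ _ ab ->] := S2P i iS; have Vv : V v by rewrite -bjv.
  by move=> iv; have [] := step_upP (Va i) Vv iv.
have S2v i : i \in S2 -> v < a i.
  move=> iS; rewrite ltNge le_eqVlt; apply/negP => /orP[/eqP/av//|iv].
  have := max1 _ Q'; rewrite min_shift gerDl leNgt => /negP; apply.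
  rewrite (bigD1 i) /=; last by rewrite iS.
  by have [_ _ ab ->] := S2P i iS; have := u_gt0 i ab; lia.
have low0 : (\sum_(i in S2 | (a i < v)%R) mu i = 0)%N.
  by apply: big1 => i /andP[/S2v]; lia.
have := max2 _ (conj Q' _); rewrite min_shift low0 addr0 => /(_ eq1); rewrite leNgt => /negP; apply.
apply: sum_sqr_shift => //.
  case/finset.set0Pn: S0 => i; rewrite finset.in_setU => /orP[iS|iS].
    by rewrite (bigD1 i) //=; have [iL ->] := S1P i iS; have := d_gt0 i iL; lia.
  by rewrite bal (bigD1 i) //=; have [_ _ ab ->] := S2P i iS; have := u_gt0 i ab; lia.
move=> f i fS iS; apply: Lowle; [by case: (S1P f fS) | | exact: noIm | ].
  by have [iL _ _ _] := S2P i iS; rewrite finset.in_setC.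
by rewrite finset.in_setU [X in _ || X]inE S2v ?orbT.
Qed.

(** * Comparison of the two tuples *)

(** Reflecting the line and exchanging the two tuples keeps up indices up, but
    exchanges gaps above [a] with gaps below [b]. *)
Definition mirror (T : Type) (a : T -> int) : T -> int := fun i => - a i.

Lemma mirrorK (T : Type) (a : T -> int) : mirror (mirror a) = a.
Proof. by apply/funext => i; rewrite /mirror opprK. Qed.

Lemma cost_mirror (T : finType) (a b : T -> int) : cost (mirror b) (mirror a) = cost a b.
Proof. by apply: eq_bigr => i _; rewrite /mirror; lia. Qed.

Lemma costC (T : finType) (a b : T -> int) : cost b a = cost a b.
Proof. by apply: eq_bigr => i _; rewrite distrC. Qed.

Lemma separates_mirror (V : set int) (T : finType) (far : (T -> int) -> (T -> int) -> Prop) :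
  separates V far ->
  separates (fun z => V (- z)) (fun a b => far (mirror b) (mirror a)).
Proof.
move=> [valid left right neq]; split.
- by move=> a b /valid[Vb Va e]; split=> //; move: e; rewrite /mirror !sumrN => /oppr_inj.
- move=> a a' b fab Va' e [i ai]; apply: (right _ (mirror a)) => //.
    by rewrite /mirror !sumrN e.
  by exists i; rewrite /mirror ai.
- move=> a b b' fab Vb' e [i bi]; apply: (left (mirror b)) => //.
    by rewrite /mirror !sumrN e.
  by exists i; rewrite /mirror bi.
- by move=> a b i j fab ab; apply: (neq _ _ j i fab); rewrite /mirror ab.
Qed.

Lemma separatesC (V : set int) (T : finType) (far : (T -> int) -> (T -> int) -> Prop) :
  separates V far -> separates V (fun a b => far b a).
Proof.
move=> [valid left right neq]; split.
- by move=> a b /valid[].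
- by move=> a a' b; apply: right.
- by move=> a b b'; apply: left.
- by move=> a b i j fab /esym; apply: neq fab.
Qed.

Lemma closest_mirror (T : finType) (far : (T -> int) -> (T -> int) -> Prop) (a b : T -> int) :
  closest far a b -> closest (fun a b => far (mirror b) (mirror a)) (mirror b) (mirror a).
Proof.
move=> [fab min_ab]; split; first by rewrite !mirrorK.
by move=> a' b' /min_ab; rewrite !cost_mirror.
Qed.

Lemma closestC (T : finType) (far : (T -> int) -> (T -> int) -> Prop) (a b : T -> int) :
  closest far a b -> closest (fun a b => far b a) b a.
Proof.
by move=> [fab min_ab]; split=> // a' b' /min_ab; rewrite (costC a b) (costC b').
Qed.

Lemma gap_pairs_le_mirror (V : set int) (D : nat) :
  gap_pairs_le V D -> gap_pairs_le (fun z => V (- z)) D.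
Proof.
move=> h [x y] [x' y'] /gap_opp g /gap_opp g' ne.
have /(h _ _ g g') : (- y, - x) <> (- y', - x').
  by move=> [/oppr_inj e /oppr_inj e']; apply: ne; rewrite e e'.
by rewrite /gap_size /=; lia.
Qed.

Lemma stalled_mirror (V : set int) (T : finType) (far : (T -> int) -> (T -> int) -> Prop)
    (D : nat) (a b0 : T -> int) (w : int) :
  separates V far -> gap_pairs_le V D -> (D < #|T|)%N -> (1 < D)%N ->
  closest far a b0 -> (exists j, a j = w) -> (exists i, a i < b0 i) ->
  (forall i y, b0 i < a i -> gap V (b0 i, y) ->
     y - b0 i <= #|[set i | (a i < b0 i)%R]|%:Z) ->
  exists b, [/\ closest far a b, forall i, (a i < b i) = (a i < b0 i),
    forall i, b0 i < a i -> b i = b0 i &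
    exists f x, [/\ a f < b f, w < b f, gap V (x, b f) &
      (#|[set i | (b0 i < a i)%R]| + #|[set i | (a i < b0 i)%R & (b i < w)%R]|)%N%:Z < b f - x]].
Proof.
move=> sep gapsD DT D1 cl [j ajw] [i0 i0up] up_le.
have mE (c d : T -> int) i : (mirror c i < mirror d i) = (d i < c i) by rewrite /mirror ltrN2.
have setE (c d : T -> int) : [set i | mirror c i < mirror d i]%SET = [set i | d i < c i]%SET.
  by apply/finset.setP => i; rewrite !inE mE.
have [|||b [clb up_eq down_eq [f [x [ab bw gf big]]]]] :=
  @stalled _ _ _ D (mirror b0) (mirror a) (- w) (separates_mirror sep)
    (gap_pairs_le_mirror gapsD) DT D1 (closest_mirror cl).
- by exists j; rewrite /mirror ajw.
- by exists i0; rewrite mE.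
- move=> i y; rewrite mE setE => ba /gap_opp; rewrite /mirror opprK => /(up_le _ _ ba); lia.
exists (mirror b); split.
- have [/= fab min_ab] := clb; rewrite mirrorK in fab; split=> // a' b' fab'.
  by rewrite -[a]mirrorK cost_mirror -(cost_mirror a'); apply: min_ab; rewrite !mirrorK.
- by move=> i; have := up_eq i; rewrite mE /mirror; lia.
- by move=> i ba; have := down_eq i; rewrite mE => /(_ ba); rewrite /mirror; lia.
- exists f, (- x); split.
  + by move: ab; rewrite /mirror; lia.
  + by move: bw; rewrite /mirror; lia.
  + exact/gap_opp.
  + move: big; rewrite setE.
    have -> : [set i | mirror b0 i < mirror a i & (- w < b i)%R]%SET =
        [set i | a i < b0 i & mirror b i < w]%SET.
      by apply/finset.setP => i; rewrite !inE mE /mirror; congr (_ && _); lia.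
    by rewrite /mirror; lia.
Qed.

(** The bound on the gaps next to the down indices allows [stalled] to be applied
    to [a0] and then its mirror image to [b0].  The second step preserves the
    conclusion of the first, which depends only on [a] and on the up indices.
    The resulting gaps are so large that the indices [St] that jump over the
    whole range from [v] to [w] of the down indices outnumber the latter. *)
Lemma closest_with_many_up_absurd (V : set int) (T : finType)
    (far : (T -> int) -> (T -> int) -> Prop) (D : nat) (a0 b0 : T -> int) :
  separates V far -> gap_pairs_le V D -> (D < #|T|)%N -> (1 < D)%N ->
  closest far a0 b0 ->
  (forall i g, b0 i < a0 i -> gap V g -> g.2 = a0 i \/ g.1 = b0 i ->
     gap_size g <= #|[set i | (a0 i < b0 i)%R]|%:Z) -> False.
Proof.
move=> sep gapsD DT D1 cl0 down_le; have [far0 _] := cl0.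
have [valid _ _ neq] := sep; have [Va0 Vb0 sum0] := valid _ _ far0.
have [t0 _] : exists t0 : T, true.
  by have /card_gt0P[t _] : (0 < #|T|)%N by lia; exists t.
have [i0 i0up] : exists i, a0 i < b0 i.
  apply: contrapT => none; have le i : 0 <= a0 i - b0 i.
    by rewrite subr_ge0 leNgt; apply/negP => lt; apply: none; exists i.
  have s0 : \sum_i (a0 i - b0 i) = 0 by rewrite sumrB sum0 subrr.
  have := psumr_eq0P (fun i _ => le i) s0 (i := t0) isT.
  by move/eqP; rewrite subr_eq0 => /eqP /(neq _ _ _ _ far0).
have [j0 j0down] : exists j, b0 j < a0 j.
  apply: contrapT => none; have le i : 0 <= b0 i - a0 i.
    by rewrite subr_ge0 leNgt; apply/negP => lt; apply: none; exists i.
  have s0 : \sum_i (b0 i - a0 i) = 0 by rewrite sumrB sum0 subrr.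
  have := psumr_eq0P (fun i _ => le i) s0 (i := t0) isT.
  by move/eqP; rewrite subr_eq0 => /eqP /esym /(neq _ _ _ _ far0).
pose Im := [set i | b0 i < a0 i]%SET.
have j0Im : j0 \in Im by rewrite inE.
have [jv jvIm vmin] := @Order.TotalTheory.arg_minP _ _ T j0 [in Im] b0 j0Im.
have [jw jwIm wmax] := @Order.TotalTheory.arg_maxP _ _ T j0 [in Im] a0 j0Im.
rewrite /= !inE in jvIm jwIm.
set v := b0 jv in vmin; set w := a0 jw in wmax.
have vw : v < w by have := vmin jw; rewrite inE /v /w => /(_ jwIm); lia.
have [|||a [cl up_eq down_eq [e [y [_ aev ge big_e]]]]] :=
  @stalled V T far D a0 b0 v sep gapsD DT D1 cl0.
- by exists jv.
- by exists i0.
- by move=> i x ba gx; apply: (down_le i (x, a0 i) ba gx); left.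
have a_down i : (b0 i < a i) = (b0 i < a0 i).
  have [fab _] := cl; have := up_eq i; have := neq _ _ i i fab; have := neq _ _ i i far0; lia.
have upE : [set i | a i < b0 i]%SET = [set i | a0 i < b0 i]%SET.
  by apply/finset.setP => i; rewrite !inE up_eq.
have downE : [set i | b0 i < a i]%SET = Im by apply/finset.setP => i; rewrite !inE a_down.
have [|||b [cl' up_eq' down_eq' [f [x [_ wbf gf big_f]]]]] :=
  @stalled_mirror V T far D a b0 w sep gapsD DT D1 cl.
- by exists jw; rewrite down_eq.
- by exists i0; rewrite up_eq.
- by move=> i y'; rewrite a_down upE => ba gy; apply: (down_le i (b0 i, y') ba gy); right.
rewrite downE in big_f.
have [fab _] := cl'; have [Va Vb sumab] := valid _ _ fab.
have b_down i : i \in Im -> a i = a0 i /\ b i = b0 i.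
  by rewrite inE => ba; rewrite down_eq // down_eq' // a_down.
have up_ab i : (i \notin Im) = (a i < b i).
  rewrite inE up_eq' up_eq -leNgt le_eqVlt; case: eqP => // /(neq _ _ _ _ far0) [].
have yv : y <= v.
  by have /gapE[_ _ _ nV] := ge; have := nV v (Vb0 jv); lia.
have wx : w <= x.
  by have /gapE[_ _ _ nV] := gf; have := nV w (Va0 jw); lia.
have eD : (y - a e) + (b f - x) <= D%:Z.
  have ey : a e < y by case/gapE: ge.
  by apply: (gapsD _ _ ge gf) => -[]; lia.
pose A1 := [set i | a0 i < b0 i & v < a i]%SET.
pose A2 := [set i | a i < b0 i & b i < w]%SET.
pose St := [set i | a i < v & w < b i]%SET.
have cover : (#|T| <= #|Im| + #|A1| + #|A2| + #|St|)%N.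
  rewrite -cardsT; apply: (@leq_trans #|Im :|: A1 :|: A2 :|: St|).
    apply: subset_leq_card; apply/fintype.subsetP => i _.
    rewrite !finset.in_setU; case iIm : (i \in Im) => //=.
    have ab : a0 i < b0 i.
      by rewrite -up_eq -up_eq' -up_ab iIm.
    rewrite !inE up_eq ab /=.
    have av : a i <> v by apply: neq cl.1.
    have bw : b i <> w by move=> bw; apply: (neq _ _ jw i fab); rewrite bw down_eq.
    by lia.
  by apply: leq_trans (leq_card_setU _ _) _; rewrite leq_add2r;
     apply: leq_trans (leq_card_setU _ _) _; rewrite leq_add2r leq_card_setU.
have more : (#|Im| < #|St|)%N.
  by move: big_e big_f; rewrite -/Im -/A1 -/A2; lia.
have StIm : [disjoint St & Im].
  rewrite disjoint_subset; apply/fintype.subsetP => i; rewrite [i \in St]inE => /andP[aiv wbi].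
  by apply: (etrans (up_ab i)); lia.
have : \sum_(i in St) (w - v) + \sum_(i in Im) (v - w) <= \sum_i (b i - a i).
  rewrite (bigID [in Im] xpredT) addrC /=; apply: lerD.
    apply: ler_sum => i iIm; have [-> ->] := b_down i iIm.
    by apply: lerB; [exact: vmin | exact: wmax].
  rewrite [X in _ <= X](bigID [in St]) /= -[X in X <= _]addr0; apply: lerD.
    rewrite [X in _ <= X](eq_bigl [in St]); last first.
      by move=> i /=; case iSt : (i \in St); rewrite ?andbF ?andbT // (disjointFr StIm iSt).
    by apply: ler_sum => i; rewrite inE => /andP[]; lia.
  by apply: sumr_ge0 => i /andP[]; rewrite up_ab; lia.
rewrite [X in _ <= X]sumrB sumab subrr !sumr_const => h.
have : (w - v) *+ #|St| <= (w - v) *+ #|Im| by move: h; rewrite -opprB mulNrn; lia.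
by rewrite ler_pMn2l ?subr_gt0 // leqNgt more.
Qed.

(** It remains to see that, up to exchanging [a] and [b], the gaps next to the
    down indices are no larger than the number of up indices.  Otherwise there
    are two gaps, one next to a down index and larger than the number of up
    indices, the other next to an up index and larger than the number of down
    indices.  They are distinct, so their sizes add up to at most [D], whereas
    the numbers of up and down indices add up to [#|T| > D]. *)
Lemma no_far_pair (V : set int) (T : finType) (far : (T -> int) -> (T -> int) -> Prop)
    (D : nat) (a b : T -> int) :
  separates V far -> gap_pairs_le V D -> (D < #|T|)%N -> (1 < D)%N -> ~ far a b.
Proof.
move=> sep gapsD DT D1; move: a b => a1 b1 far1; have T2 : (2 < #|T|)%N by lia.
have [a [b cl]] : exists a b, closest far a b.
  have [|[a b] _ |[a b] [fab minab]] := @exists_max_int _ (fun ab => far ab.1 ab.2)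
      (fun ab => - cost ab.1 ab.2) 0.
  - by exists (a1, b1).
  - by rewrite oppr_le0 sumr_ge0.
  - exists a, b; split=> // a' b' fab'; have := minab (a', b') fab'; rewrite /=; lia.
have [fab _] := cl; have [valid _ _ neq] := sep.
have cl_m := closest_mirror cl.
case: (pselect (forall i g, b i < a i -> gap V g -> g.2 = a i \/ g.1 = b i ->
     gap_size g <= #|[set i | (a i < b i)%R]%SET|%:Z)) => [|not_down].
  exact: (closest_with_many_up_absurd sep gapsD DT D1 cl).
case: (pselect (forall i g, a i < b i -> gap V g -> g.2 = b i \/ g.1 = a i ->
     gap_size g <= #|[set i | (b i < a i)%R]%SET|%:Z)) => [|not_up].
  exact: (closest_with_many_up_absurd (separatesC sep) gapsD DT D1 (closestC cl)).
have [i [[x y] [bai gi gxy big_i]]] : exists i g, [/\ b i < a i, gap V g, g.2 = a i \/ g.1 = b i &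
    #|[set i | (a i < b i)%R]%SET|%:Z < gap_size g].
  apply: contrapT => none; apply: not_down => i g ba gg gab; rewrite leNgt; apply/negP => big.
  by apply: none; exists i, g.
have [j [[x' y'] [abj gj gxy' big_j]]] : exists i g, [/\ a i < b i, gap V g, g.2 = b i \/ g.1 = a i &
    #|[set i | (b i < a i)%R]%SET|%:Z < gap_size g].
  apply: contrapT => none; apply: not_up => k g ba gg gab; rewrite leNgt; apply/negP => big.
  by apply: none; exists k, g.
have card_T : (#|T| <= #|[set i | (a i < b i)%R]%SET| + #|[set i | (b i < a i)%R]%SET|)%N.
  rewrite -cardsT; apply: leq_trans (leq_card_setU _ _); apply: subset_leq_card.
  by apply/fintype.subsetP => k _; rewrite !inE; have := neq _ _ k k fab; lia.
have /(gapsD _ _ gi gj) : (x, y) <> (x', y').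
  move=> e; rewrite -e in gj gxy'; case: gxy => /= e1; case: gxy' => /= e2.
  - by apply: (neq _ _ i j fab); rewrite -e1.
  - by subst x y; apply: (crossings_distinct sep T2 cl bai abj gi gj).
  - subst x y.
    apply: (crossings_distinct (separates_mirror sep) T2 cl_m (i := i) (j := j)
      (x := - b j) (y := - b i)).
    + by rewrite /mirror ltrN2.
    + by rewrite /mirror ltrN2.
    + by apply/gap_opp; rewrite /mirror !opprK.
    + by apply/gap_opp; rewrite /mirror !opprK.
    + by [].
  - by apply: (neq _ _ j i fab); rewrite -e1.
by lia.
Qed.

(** * From tuples to the complex *)

Lemma tuple_of_Pi (V : set int) (q : nat) (c : int) (M : {mset int}%mset) (x : int) :
  Pi_mset V q c M -> x \in finsupp M ->
  exists a : 'I_q -> int, [/\ forall i, V (a i), \sum_i a i = c & exists i, a i = x].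
Proof.
move=> [MV Mq Mc] xM; exists (fun i => nth 0 M i); split.
- by move=> i; apply: MV; rewrite msuppE; apply: mem_nth; rewrite Mq.
- by rewrite -Mc -[in RHS](mkseq_nth 0 M) /mkseq big_map Mq -val_enum_ord big_map big_enum.
- rewrite msuppE in xM.
  have iq : (index x M < q)%N by rewrite -Mq index_mem.
  by exists (Ordinal iq); rewrite /= nth_index.
Qed.

Lemma tuple_simplex (V : set int) (q : nat) (c : int) (a : 'I_q -> int) (i j : 'I_q) :
  (forall i, V (a i)) -> \sum_i a i = c -> Delta V q c [fset a i; a j]%fset.
Proof.
move=> Va ac; pose M := seq_mset [seq a i | i : 'I_q].
have pM : perm_eq M [seq a i | i : 'I_q] by apply: perm_eq_seq_mset.
exists (finsupp M).
  exists M => //; split.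
  - by move=> x; rewrite msuppE (perm_mem pM) => /mapP[k _ ->].
  - by rewrite (perm_size pM) size_map size_enum_ord.
  - by rewrite (perm_big _ pM) /= big_map big_enum.
apply/fsubsetP => x; rewrite !inE => /orP[]/eqP->; rewrite msuppE (perm_mem pM);
by apply: map_f; rewrite mem_enum.
Qed.

Local Close Scope set_scope.
Local Open Scope classical_set_scope.
Local Open Scope card_scope.
Local Open Scope ring_scope.

Theorem theorem2 (V : set int) (r s : int)
    (hV : `I_3 #<= V)
    (hbdd : has_ubound [set gap_size g | g in gap V])
    (hrs : two_largest_gap_sizes V r s)
    (q : nat) (c : int) (hq : r + s < q%:Z) :
  connected_complex (Delta V q c).
Proof.
pose reach x y := exists2 p : seq int,
  path (fun u v => `[< edge (Delta V q c) u v >]) x p & last x p = y.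
have reach_trans x y z : reach x y -> reach y z -> reach x z.
  move=> [p px <-] [p' py' <-]; exists (p ++ p'); last by rewrite last_cat.
  by rewrite cat_path px py'.
pose valid (a : 'I_q -> int) := (forall i, V (a i)) /\ \sum_i a i = c.
have reach_tuple a i j : valid a -> reach (a i) (a j).
  move=> [Va ac]; case: (eqVneq (a i) (a j)) => [->|ne]; first by exists nil.
  exists [:: a j] => //=; rewrite andbT; apply/asboolP; split=> //.
  exact: tuple_simplex.
pose far a b := [/\ valid a, valid b & forall i j, ~ reach (a i) (b j)].
have sep : separates V far.
  split.
  - by move=> a b [[Va ac] [Vb bc] _]; split=> //; rewrite ac bc.
  - move=> a a' b [va vb far_ab] Va' sum_a' [k ak].
    have va' : valid a' by split=> //; rewrite sum_a'; case: va.
    split=> // i j rij; apply: (far_ab k j); rewrite -ak.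
    exact: reach_trans (reach_tuple _ _ i va') rij.
  - move=> a b b' [va vb far_ab] Vb' sum_b' [k bk].
    have vb' : valid b' by split=> //; rewrite sum_b'; case: vb.
    split=> // i j rij; apply: (far_ab i k); rewrite -bk.
    exact: reach_trans rij (reach_tuple _ _ _ vb').
  - by move=> a b i j [_ _ far_ab] ab; apply: (far_ab i j); rewrite ab; exists nil.
have [g1 [g2 [[gap1 gap2 /eqP g12 size1 size2] [le_r le_s]]]] := hrs.
have gap_pos g : gap V g -> 0 < gap_size g.
  by case: g => u v /gapE[_ _ uv _]; rewrite /gap_size /= subr_gt0.
have r0 : 0 < r by rewrite -size1 gap_pos.
have s0 : 0 < s by rewrite -size2 gap_pos.
have sr : s <= r by rewrite -size2 le_r.
have gapsD : gap_pairs_le V `|(r + s)%R|%N.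
  move=> g g' Gg Gg' gg'; have := le_r _ Gg; have := le_r _ Gg'.
  case: (eqVneq g g1) => [e|ne].
    have : gap_size g' <= s by apply: le_s => //; apply/eqP => e'; apply: gg'; rewrite e e'.
    by lia.
  by have := le_s _ Gg ne; lia.
move=> x y [_ [M PM <-] xM] [_ [N PN <-] yN].
rewrite fsub1set in xM; rewrite fsub1set in yN.
have [a [Va ac [i ax]]] := tuple_of_Pi PM xM.
have [b [Vb bc [j bY]]] := tuple_of_Pi PN yN.
apply: contrapT => not_reach.
have fab : far a b.
  split=> // k l rkl; apply: not_reach.
  have va : valid a by [].
  have vb : valid b by [].
  rewrite -ax -bY; apply: (reach_trans _ (a k)); first exact: reach_tuple.
  exact: reach_trans rkl (reach_tuple b l j vb).
by apply: (no_far_pair sep gapsD _ _ fab); rewrite ?card_ord; lia.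
Qed.
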